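(* Let $\{X_i\}_{i=1}^{\infty}$ be a sequence of negatively associated random variables on the upper probability space $(\Omega,\mathcal{F},\mathcal{P},\mathbb{V})$ such that $\sup_{i\ge 1}\mathbb{E}[|X_i|^{\alpha+1}]<\infty$ for some constant $\alpha>0$. Then $$\mathbb{V}\left(\left\{\liminf_{n\to\infty}\frac{\sum_{i=1}^{n}(X_i-\mathcal{E}[X_i])}{n}<0\right\}\cup\left\{\limsup_{n\to\infty}\frac{\sum_{i=1}^{n}(X_i-\mathbb{E}[X_i])}{n}>0\right\}\right)=0,$$ and also $$v\left(\liminf_{n\to\infty}\frac{\sum_{i=1}^{n}(X_i-\mathcal{E}[X_i])}{n}\ge 0\right)=1,\qquad v\left(\limsup_{n\to\infty}\frac{\sum_{i=1}^{n}(X_i-\mathbb{E}[X_i])}{n}\le 0\right)=1.$$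
   Context: Let $(\Omega,\mathcal{F})$ be a measurable space and $\mathcal{P}$ a nonempty set of probability measures on it. For $A\in\mathcal{F}$ set $\mathbb{V}(A)=\sup_{P\in\mathcal{P}}P(A)$ (upper probability) and $v(A)=\inf_{P\in\mathcal{P}}P(A)$ (lower probability). For a random variable $X$ with $E_P[|X|]<\infty$ for all $P\in\mathcal{P}$ (or $X\ge 0$, with values in $[0,\infty]$ allowed for the expectation), set $\mathbb{E}[X]=\sup_{P\in\mathcal{P}}E_P[X]$ and $\mathcal{E}[X]=\inf_{P\in\mathcal{P}}E_P[X]$, where $E_P$ is the classical expectation under $P$. $(\Omega,\mathcal{F},\mathcal{P},\mathbb{V})$ is called the upper probability space. Let $C_b^+(\mathbb{R})$ be the set of nonnegative bounded continuous functions on $\mathbb{R}$. Functions have ''the same monotonicity'' if they are all nondecreasing or all nonincreasing. A sequence $\{X_i\}_{i=1}^{\infty}$ of random variables is negatively associated if for every $n\ge 1$ and every sequence $\{f_i\}_{i=1}^{\infty}\subset C_b^+(\mathbb{R})$ with the same monotonicity, $\mathbb{E}\left[\prod_{i=1}^{n+1}f_i(X_i)\right]\le \mathbb{E}\left[\prod_{i=1}^{n}f_i(X_i)\right]\,\mathbb{E}[f_{n+1}(X_{n+1})]$. *)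

(* Defs.v *)
From HB Require Import structures.
From mathcomp Require Import all_boot all_order all_algebra.
From mathcomp Require Import all_classical all_reals all_analysis.

Set Implicit Arguments.
Unset Strict Implicit.
Unset Printing Implicit Defensive.

Import Order.TTheory GRing.Theory Num.Theory.
Import numFieldNormedType.Exports.

Local Open Scope classical_set_scope.
Local Open Scope ring_scope.

Definition upper_prob (d : measure_display) (T : measurableType d)
    (R : realType) (PP : set (probability T R)) (A : set T) : \bar R :=
  ereal_sup [set P A | P in PP].

Definition lower_prob (d : measure_display) (T : measurableType d)
    (R : realType) (PP : set (probability T R)) (A : set T) : \bar R :=
  ereal_inf [set P A | P in PP].

(* The expectations are extended-real valued. For random variables that are
   neither nonnegative nor P-integrable for every P in PP, the values below
   carry no meaning. *)
Definition upper_expectation (d : measure_display) (T : measurableType d)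
    (R : realType) (PP : set (probability T R)) (X : T -> R) : \bar R :=
  ereal_sup [set 'E_P[X]%E | P in PP].

Definition lower_expectation (d : measure_display) (T : measurableType d)
    (R : realType) (PP : set (probability T R)) (X : T -> R) : \bar R :=
  ereal_inf [set 'E_P[X]%E | P in PP].

Definition Cb_plus (R : realType) : set (R -> R) :=
  [set f : R -> R | [/\ continuous f, bounded_fun f & forall x, 0 <= f x]].

Definition same_monotonicity (R : realType) (f : nat -> R -> R) : Prop :=
  (forall i, nondecreasing_fun (f i)) \/ (forall i, nonincreasing_fun (f i)).

(* Sequences are indexed from 0: X i and f i stand for X_(i+1) and f_(i+1). *)
Definition negatively_associated (d : measure_display) (T : measurableType d)
    (R : realType) (PP : set (probability T R)) (X : nat -> T -> R) : Prop :=
  forall (n : nat) (f : nat -> R -> R), (1 <= n)%N ->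
    (forall i, Cb_plus (f i)) -> same_monotonicity f ->
    (upper_expectation PP (fun w => (\prod_(i < n.+1) f i (X i w))%R)
     <= upper_expectation PP (fun w => (\prod_(i < n) f i (X i w))%R)
        * upper_expectation PP (fun w => f n (X n w)))%E.

(* (\sum_{i=1}^n (X_i(w) - m_i)) / n, with value 0 at n = 0. *)
Definition centered_mean (T : Type) (R : realType) (X : nat -> T -> R)
    (m : nat -> \bar R) (w : T) (n : nat) : \bar R :=
  ((\sum_(i < n) ((X i w)%:E - m i)) * (n%:R^-1)%:E)%E.

(* Main.v *)
Require Import Defs.
From HB Require Import structures.
From mathcomp Require Import all_boot all_order all_algebra.
From mathcomp Require Import all_classical all_reals all_analysis.
From mathcomp Require Import measurable_realfun.
From mathcomp Require Import ring lra.

Set Implicit Arguments.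
Unset Strict Implicit.
Unset Printing Implicit Defensive.

Import Order.TTheory GRing.Theory Num.Theory.
Import numFieldNormedType.Exports.

Local Open Scope classical_set_scope.
Local Open Scope ring_scope.

(** The law of large numbers needs no maximal inequality: for each fixed P in
    PP, two applications of the first Borel-Cantelli lemma are enough.

    Write p = 1 + min(alpha, 1), so that p lies in ]1, 2] and the p-th absolute
    moments are bounded by a constant M uniformly in the index and in P. Fix an
    exponent b in ]1/p, 1[ and truncate from above only, replacing X_i by
    min(X_i, (i+1)^b). Since b p > 1, the tails P(X_i > (i+1)^b) are summable
    ([powR_moment_tail_le]), so that almost surely only finitely many X_i
    are changed.

    For the truncated sum, x |-> exp(t min(x, c)) is nonnegative, bounded,
    continuous and nondecreasing, hence an admissible test function for
    negative association. Iterating the defining inequality bounds the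
    exponential moment of the sum under any P of PP by the product of the upper
    exponential moments ([negatively_associated_prod_le]). The inequality
    e^x <= 1 + x + 2|x|^p, valid for x <= 1/2, bounds each factor by
    exp(t m_i + 2 M t^p) as soon as t c <= 1/2, where m_i bounds the mean of X_i
    from above ([expectation_expR_minr_le]); truncating from above can only
    decrease the mean, so the m_i of the original variables can be used. With
    t = n^(-b) / 2, Chernoff's inequality gives
      P(sum of the first n truncated X_i >= sum of m_i + e n)
        <= exp(- n t (e - 2 M t^(p-1))),
    and for large n the right-hand side is at most exp(- e n^(1-b) / 4), which
    is summable ([negatively_associated_truncated_tail]).

    Both bounds are compared with the series of n^(-b p). It follows that P-almost
    surely the sums of X_i - m_i are eventually below e n, for every e > 0
    ([negatively_associated_ae_sum_le]). Taking for m_i the upper expectation of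
    X_i gives the statement on the limit superior. The one on the limit inferior
    is the same result for the variables - X_i, which are again negatively
    associated and whose upper expectations are the opposites of the lower
    expectations of the X_i. *)

(** * Powers and exponentials *)

(** On [-1, 1/2] this comes from e^x <= 1/(1-x) and x^2 <= |x|^p, which needs
    p <= 2; below -1 the right-hand side exceeds 1 because |x| <= |x|^p.
    Since it holds for arbitrarily negative x, truncating a variable from above
    is enough to apply it. *)
Lemma expR_le_1Dx_powR (R : realType) (p x : R) : 1 <= p <= 2 -> x <= 2^-1 ->
  expR x <= 1 + x + 2 * `|x| `^ p.
Proof.
move=> /andP[p1 p2] x2.
have [x1|x1] := leP `|x| 1.
  have [->|x0] := eqVneq x 0.
    by rewrite expR0 addr0 lerDl mulr_ge0 ?powR_ge0.
  have nx0 : 0 < `|x| by rewrite normr_gt0.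
  have h : x ^+ 2 <= `|x| `^ p.
    rewrite -(real_normK (num_real x)) -powR_mulrn//.
    by apply: ger_powR => //; rewrite nx0.
  have h1 : expR x <= (1 - x)^-1.
    rewrite -[x in leLHS]opprK expRN lef_pV2 ?posrE ?expR_gt0//; last lra.
    exact: expR_ge1Dx.
  apply: le_trans h1 _; apply: (@le_trans _ _ (1 + x + 2 * x ^+ 2)).
    rewrite -[leLHS]mul1r ler_pdivrMr; last lra.
    have -> : (1 + x + 2 * x ^+ 2) * (1 - x) = 1 + x ^+ 2 * (1 - 2 * x) by ring.
    by rewrite lerDl mulr_ge0 ?sqr_ge0//; lra.
  by rewrite lerD2l ler_pM2l.
have x0 : x < 0.
  by rewrite ltNge; apply/negP => x0; move: x1; rewrite ger0_norm//; lra.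
have h : `|x| <= `|x| `^ p by apply: le1r_powR => //; exact: ltW.
have : expR x <= 1 by rewrite expR_le1 ltW.
move: x1 h; rewrite ltr0_norm//; lra.
Qed.

(** Comparison with a telescoping series: with a = s - 1,
    the increment n^(-a) - (n+1)^(-a) is at least a (n+1)^(-s). *)
Lemma is_cvg_riemannR (R : realType) (s : R) : 1 < s ->
  cvgn (series (riemannR s)).
Proof.
move=> s1; pose a := s - 1.
have a0 : 0 < a by rewrite subr_gt0.
pose u n : R := n.+1%:R `^ (- a).
have le n : a * riemannR s n.+1 <= u n - u n.+1.
  have n0 : (0 : R) < n.+1%:R by rewrite ltr0n.
  have n1 : (0 : R) < n.+2%:R by rewrite ltr0n.
  rewrite /u /riemannR -powRN.
  have -> : - s = - a + (- 1) by rewrite /a; ring.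
  rewrite powRD ?(gt_eqF n1) ?implybT// powR_inv1 ?(ltW n1)//.
  have -> : n.+1%:R `^ (- a) = n.+2%:R `^ (- a) * (n.+1%:R / n.+2%:R) `^ (- a) :> R.
    by rewrite -powRM ?(ltW n1) ?divr_ge0 ?(ltW n0)// mulrC divfK// gt_eqF.
  rewrite -[X in _ - X]mulr1 -mulrBr mulrCA ler_pM2l ?powR_gt0// lerBrDl.
  apply: le_trans (expR_ge1Dx _) _.
  rewrite /powR gt_eqF ?divr_gt0// ler_expR.
  rewrite mulNr -mulrN ler_pM2l//.
  have -> : n.+1%:R / n.+2%:R = 1 + (- n.+2%:R^-1) :> R.
    by rewrite -[in LHS](@natr1 _ n.+1) -{1}[n.+1%:R](addrK 1) natr1; field; rewrite gt_eqF.
  (* (1 - 1/(n+2))^(-a) >= 1 + a/(n+2), from ln (1 + x) <= x at x = -1/(n+2). *)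
  rewrite lerNr; apply: le_ln1Dx.
  by rewrite ltrN2 invf_lt1// ltr1n.
apply: nondecreasing_is_cvgn.
  by apply: nondecreasing_series => i _ _; rewrite ltW ?riemannR_gt0//; lra.
exists (1 + a^-1) => _ [n _ <-].
have tel m : series (riemannR s) m.+1 <= 1 + a^-1 * (1 - u m).
  elim: m => [|m ih].
    by rewrite seriesEnat /= big_nat1 /u /riemannR !powR1 subrr mulr0 addr0 invr1.
  rewrite seriesSr.
  have := le m; rewrite -ler_pdivlMl// => h.
  apply: le_trans (lerD ih h) _.
  by rewrite -addrA -mulrDr addrA subrK.
case: n => [|n].
  by rewrite seriesEnat /= big_nil addr_ge0// invr_ge0 ltW.
apply: le_trans (tel n) _; rewrite lerD2l -[leRHS]mulr1 ler_pM2l ?invr_gt0//.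
by rewrite gerBl powR_ge0.
Qed.

(** Stretched exponentials decay faster than any power: this turns
    exp(- C n^g) into a constant times n^(- g k), for k as large as needed. *)
Lemma expRN_le_powR (R : realType) (y k : R) : 0 < k -> 0 < y ->
  expR (- y) <= (y / k) `^ (- k).
Proof.
move=> k0 y0; rewrite expRN powRN lef_pV2 ?posrE ?expR_gt0 ?powR_gt0 ?divr_gt0//.
have -> : expR y = (expR (y / k)) `^ k by rewrite -expRM divfK// gt_eqF.
apply: ge0_ler_powR; rewrite ?nnegrE ?expR_ge0 ?divr_ge0 ?ltW//.
by apply: lt_le_trans (expR_ge1Dx _); rewrite ltrDr.
Qed.

Lemma near_powRN_le (R : realType) (r e : R) : 0 < r -> 0 < e ->
  \forall n \near \oo, (n.+1%:R : R) `^ (- r) <= e.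
Proof.
move=> r0 e0; near=> n.
have n0 : (0 : R) < n.+1%:R by rewrite ltr0n.
rewrite powRN -[leRHS]invrK lef_pV2 ?posrE ?invr_gt0 ?powR_gt0//.
have -> : e^-1 = (e^-1 `^ r^-1) `^ r.
  by rewrite -powRrM mulVf ?gt_eqF// powRr1// invr_ge0 ltW.
apply: ge0_ler_powR; rewrite ?nnegrE ?powR_ge0 ?ltW//.
rewrite -natr1 ltr_wpDr//.
by near: n; exact: nbhs_infty_gtr.
Unshelve. all: by end_near. Qed.

(** * Moments and tails under a single probability *)

Lemma integrable_powR_moment d (T : measurableType d) (R : realType)
    (P : probability T R) (X : T -> R) (p : R) :
  measurable_fun setT X -> ('E_P[fun w => (`|X w| `^ p)%R] < +oo)%E ->
  P.-integrable setT (fun w => (`|X w| `^ p)%:E).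
Proof.
move=> mX; rewrite unlock => Xp; apply/integrableP; split.
  apply/measurable_EFinP; apply: measurableT_comp (measurable_powR p) _.
  exact: measurableT_comp.
by under eq_integral do rewrite /= ger0_norm ?powR_ge0//.
Qed.

(** Lowers the order of a moment: it reduces an arbitrary alpha to alpha <= 1,
    and controls the mean by the p-th moment. *)
Lemma expectation_powR_le_1D d (T : measurableType d) (R : realType)
    (P : probability T R) (X : T -> R) (p q : R) : 0 <= q <= p ->
  measurable_fun setT X -> ('E_P[fun w => (`|X w| `^ p)%R] < +oo)%E ->
  ('E_P[fun w => (`|X w| `^ q)%R] <= 1 + 'E_P[fun w => (`|X w| `^ p)%R])%E.
Proof.
move=> /andP[q0 qp] mX Xp; rewrite -(expectation_cst P) unlock -integralD//=.
- apply: ge0_le_integral => //=.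
  + apply/measurable_EFinP; apply: measurableT_comp (measurable_powR q) _.
    exact: measurableT_comp.
  + apply: emeasurable_funD => //.
    exact: measurable_int (integrable_powR_moment mX Xp).
  + move=> w _; rewrite -EFinD lee_fin.
    have [x1|x1] := leP 1 `|X w|.
      by rewrite -[leLHS]add0r lerD// ler_powR.
    apply: (@le_trans _ _ 1); last by rewrite lerDl powR_ge0.
    have <- : 1 `^ q = 1 :> R by rewrite powR1.
    by rewrite ge0_ler_powR ?nnegrE// ltW.
- exact: finite_measure_integrable_cst.
- exact: integrable_powR_moment.
Qed.

Lemma integrable_of_powR_moment d (T : measurableType d) (R : realType)
    (P : probability T R) (X : T -> R) (p : R) : 1 <= p ->
  measurable_fun setT X -> ('E_P[fun w => (`|X w| `^ p)%R] < +oo)%E ->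
  P.-integrable setT (EFin \o X).
Proof.
move=> p1 mX Xp.
have X1 : ('E_P[fun w => (`|X w| `^ 1)%R] < +oo)%E.
  apply: le_lt_trans (expectation_powR_le_1D _ mX Xp) _.
    by rewrite ler01.
  by rewrite lte_add_pinfty// ltry.
apply: le_integrable (integrable_powR_moment mX X1) => //.
  exact/measurable_EFinP.
by move=> w _ /=; rewrite lee_fin powRr1// normr_id.
Qed.

Lemma abse_expectation_le_powR_moment d (T : measurableType d) (R : realType)
    (P : probability T R) (X : {mfun T >-> R}) (p M : R) : 1 <= p ->
  ('E_P[fun w => (`|X w| `^ p)%R] <= M%:E)%E ->
  (`|'E_P[X]| <= (1 + M)%:E)%E.
Proof.
move=> p1 XM.
have Xp : ('E_P[fun w => (`|X w| `^ p)%R] < +oo)%E.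
  by apply: le_lt_trans XM _; rewrite ltry.
apply: (@le_trans _ _ 'E_P[fun w => (`|X w| `^ 1)%R]%E).
  rewrite unlock; apply: le_trans (le_abse_integral _ _ _) _ => //.
    exact/measurable_EFinP.
  by under [leRHS]eq_integral do rewrite powRr1//.
apply: le_trans (expectation_powR_le_1D _ _ Xp) _ => //.
  by rewrite ler01.
by rewrite EFinD leeD2l.
Qed.

Lemma expectationN d (T : measurableType d) (R : realType)
    (P : probability T R) (X : T -> R) : P.-integrable setT (EFin \o X) ->
  ('E_P[fun w => (- X w)%R] = - 'E_P[X])%E.
Proof.
move=> iX; have iX1 : X \in Lfun P 1 by exact/Lfun1_integrable.
rewrite -mulN1e -(expectationZl _ iX1); congr ('E_P[_])%E.
by apply/funext => w /=; rewrite mulrN1.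
Qed.

(** Taking expectations in
      exp(t min(X, c)) <= 1 + t X + 2 t^p |X|^p,
    where min(X, c) has been replaced by X in the linear term, as t > 0, and in
    the power term, as |min(X, c)| <= |X| for c >= 0. Only upper bounds on the
    mean and the p-th moment enter, so the estimate is uniform over a family of
    probabilities sharing those bounds. *)
Lemma expectation_expR_minr_le d (T : measurableType d) (R : realType)
    (P : probability T R) (X : T -> R) (p M m t c : R) :
  1 <= p <= 2 -> measurable_fun setT X ->
  ('E_P[fun w => (`|X w| `^ p)%R] <= M%:E)%E -> ('E_P[X] <= m%:E)%E ->
  0 < t -> 0 <= c -> t * c <= 2^-1 ->
  ('E_P[fun w => expR (Num.min (X w) c * t)]
    <= (expR (t * m + 2 * M * t `^ p))%:E)%E.
Proof.
move=> p12 mX XM Xm t0 c0 tc; have /andP[p1 p2] := p12.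
have Xfin : ('E_P[fun w => (`|X w| `^ p)%R] < +oo)%E.
  by apply: le_lt_trans XM _; rewrite ltry.
have iXp := integrable_powR_moment mX Xfin.
have iX := integrable_of_powR_moment p1 mX Xfin.
apply: (@le_trans _ _ (1 + t%:E * 'E_P[X]
    + (2 * t `^ p)%:E * 'E_P[fun w => (`|X w| `^ p)%R])%E); last first.
  apply: (@le_trans _ _ (1 + t%:E * m%:E + (2 * t `^ p)%:E * M%:E)%E).
    rewrite !leeD// lee_wpmul2l// lee_fin ?(ltW t0)//.
    by rewrite mulr_ge0 ?powR_ge0.
  rewrite -!EFinM -!EFinD lee_fin.
  by apply: le_trans (expR_ge1Dx _); rewrite addrA lerD2l mulrAC.
rewrite -[X in (X + _ + _)%E](expectation_cst P) unlock.
rewrite -integralZl// -integralZl//.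
have i1 : P.-integrable setT (EFin \o cst (1 : R)).
  exact: finite_measure_integrable_cst.
rewrite -integralD//=; last exact: integrableZl.
rewrite -integralD//=; first last.
- exact: integrableZl.
- by apply: integrableD => //; exact: integrableZl.
have itot : P.-integrable setT (fun w => 1 + t%:E * (X w)%:E +
    (2 * t `^ p)%:E * (`|X w| `^ p)%:E)%E.
  apply: integrableD => //; last exact: integrableZl.
  by apply: integrableD => //; exact: integrableZl.
have H w : expR (Num.min (X w) c * t) <=
    1 + t * X w + 2 * t `^ p * (`|X w| `^ p).
  have tmin : Num.min (X w) c * t <= 2^-1.
    by apply: le_trans tc; rewrite mulrC ler_pM2l// ge_min lexx orbT.
  apply: le_trans (expR_le_1Dx_powR p12 tmin) _.
  rewrite -addrA -[leRHS]addrA lerD2l lerD//.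
    by rewrite mulrC ler_pM2l// ge_min lexx.
  rewrite -mulrA ler_pM2l// -powRM ?(ltW t0)//.
  rewrite ge0_ler_powR ?nnegrE ?mulr_ge0 ?(ltW t0)//; first lra.
  rewrite normrM (gtr0_norm t0) mulrC ler_pM2l//.
  rewrite minEle; case: ifPn => // /negbTE Xc.
  by rewrite (ger0_norm c0) ler_normr; apply/orP; left; rewrite ltW// ltNge Xc.
apply: ge0_le_integral => //=.
- apply/measurable_EFinP; apply: measurableT_comp => //.
  by apply: measurable_funM => //; apply: measurable_minr.
- exact: measurable_int itot.
- by move=> w _; rewrite lee_fin.
Qed.

Lemma measurable_set_ltr d (T : measurableType d) (R : realType)
    (f : T -> R) (c : R) : measurable_fun setT f ->
  measurable [set w | c < f w].
Proof.
move=> mf; rewrite -[X in measurable X]setTI.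
exact: (measurable_fun_ltr (measurable_cst c) mf measurableT (Y := [set true])).
Qed.

Lemma measurable_set_ler d (T : measurableType d) (R : realType)
    (f : T -> R) (c : R) : measurable_fun setT f ->
  measurable [set w | c <= f w].
Proof.
move=> mf; rewrite -[X in measurable X]setTI.
exact: (measurable_fun_ler (measurable_cst c) mf measurableT (Y := [set true])).
Qed.

Lemma powR_moment_tail_le d (T : measurableType d) (R : realType)
    (P : probability T R) (X : {mfun T >-> R}) (p M c : R) : 0 <= p -> 0 < c ->
  ('E_P[fun w => (`|X w| `^ p)%R] <= M%:E)%E ->
  (P [set w | (c < X w)%R] <= (M * c `^ (- p))%:E)%E.
Proof.
move=> p0 c0 XM.
have mpow : measurable_fun setT (fun r : R => r `^ p) by exact: measurable_powR.
(* Markov's inequality for r |-> r^p. *)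
have := @markov _ _ _ P X (fun r => r `^ p) c c0 mpow.
move=> /(_ (fun r _ => powR_ge0 r p)) /(_ (ge0_ler_powR p0)) mk.
have h : (P [set w | (c < X w)%R] <= P [set x | c%:E <= `|(X x)%:E|])%E.
  apply: le_measure; rewrite ?inE.
  - exact: measurable_set_ltr.
  - by apply: (@measurable_set_ler _ _ _ (fun w => `|X w|)); exact: measurableT_comp.
  - by move=> w /= cX; rewrite lee_fin (le_trans (ltW cX))// ler_norm.
apply: le_trans h _.
rewrite powRN EFinM lee_pdivlMr ?powR_gt0// muleC.
exact: le_trans mk XM.
Qed.

(** The first Borel-Cantelli lemma, with a convergent Riemann series as the
    common majorant of all the tails met below. *)
Lemma ae_eventually_notin d (T : measurableType d) (R : realType)
    (P : probability T R) (F : nat -> set T) (K s : R) : 1 < s ->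
  (forall n, measurable (F n)) ->
  (\forall n \near \oo, (P (F n) <= (K * riemannR s n)%:E)%E) ->
  {ae P, forall w, \forall n \near \oo, ~ F n w}.
Proof.
move=> s1 mF [N _ FK].
(* Discard the finitely many events that escape the bound. *)
pose G n := if (N <= n)%N then F n else set0.
have mG n : measurable (G n) by rewrite /G; case: ifP.
have r0 n : 0 <= riemannR s n by rewrite ltW// riemannR_gt0//; lra.
have GK n : (P (G n) <= (`|K| * riemannR s n)%:E)%E.
  rewrite /G; case: ifPn => [Nn|_]; last by rewrite measure0 lee_fin mulr_ge0.
  apply: le_trans (FK n Nn) _.
  by rewrite lee_fin ler_wpM2r// ler_norm.
have sumG : (\sum_(n <oo) P (G n) < +oo)%E.
  apply: (@le_lt_trans _ _ (`|K| * limn (series (riemannR s)))%:E); last first.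
    by rewrite ltry.
  apply: lime_le; first by apply: is_cvg_nneseries.
  apply: nearW => n.
  apply: (@le_trans _ _ (\sum_(0 <= i < n) (`|K| * riemannR s i)%:E)%E).
    exact: lee_sum.
  rewrite sumEFin lee_fin -mulr_sumr ler_wpM2l//.
  apply: (nondecreasing_cvgn_le _ (is_cvg_riemannR s1) n).
  by apply: nondecreasing_series => i _ _.
exists (lim_sup_set G); split.
- by apply: bigcap_measurable => // n _; apply: bigcup_measurable.
- exact: lim_sup_set_cvg0.
- move=> w /= nw n _; apply: contrapT => nG; apply: nw.
  exists (maxn N n) => // k /=; rewrite geq_max => /andP[Nk nk] Fk.
  by apply: nG; exists k => //; rewrite /G Nk.
Qed.

(** * Consequences of negative association *)

(** Iteration of the defining inequality. The family PP has to be nonempty for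
    the upper expectation of a nonnegative function to be nonnegative, which
    allows multiplying the induction hypothesis by it. *)
Lemma negatively_associated_prod_le d (T : measurableType d) (R : realType)
    (PP : set (probability T R)) (X : nat -> T -> R) (f : nat -> R -> R)
    (n : nat) :
  PP !=set0 -> negatively_associated PP X ->
  (forall i, Cb_plus (f i)) -> same_monotonicity f ->
  (upper_expectation PP (fun w => (\prod_(i < n) f i (X i w))%R)
    <= \prod_(i < n) upper_expectation PP (fun w => f i (X i w)))%E.
Proof.
move=> [P0 PP0] NA fC fmono.
have E0 g : (forall w, 0 <= g w) -> (0 <= upper_expectation PP g)%E.
  move=> g0; apply: (@le_trans _ _ 'E_P0[g]%E); first exact: expectation_ge0.
  by apply: ereal_sup_ubound; exists P0.
have f0 i x : 0 <= f i x by have [] := fC i.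
elim: n => [|n ih].
  rewrite big_ord0; apply: ge_ereal_sup => _ [P _ <-].
  by under eq_fun do rewrite big_ord0; rewrite expectation_cst.
(* The defining inequality starts at two factors. *)
have [->|n0] := posnP n.
  by rewrite big_ord1; under eq_fun do rewrite big_ord1.
apply: le_trans (NA n f n0 fC fmono) _.
rewrite big_ord_recr/=; apply: lee_wpmul2r; first by apply: E0.
exact: ih.
Qed.

(** Precomposing the test functions with the opposite exchanges the two kinds of
    monotonicity, and negative association allows both. *)
Lemma negatively_associatedN d (T : measurableType d) (R : realType)
    (PP : set (probability T R)) (X : nat -> T -> R) :
  negatively_associated PP X ->
  negatively_associated PP (fun i w => - X i w).
Proof.
move=> NA n f n1 fC fmono; apply: (NA n (fun i x => f i (- x)) n1).
  move=> i; have [cf [B [Br fB]] f0] := fC i; split => //.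
    move=> x; apply: (@continuous_comp _ _ _ -%R (f i)); last exact: cf.
    exact: opp_continuous.
  by exists B; split => // y By x _; exact: fB.
by case: fmono => h; [right|left] => i x y xy; apply: h; rewrite lerN2.
Qed.

(** The truncation makes the exponential bounded, hence a legitimate test
    function for negative association. *)
Lemma Cb_plus_expR_minr (R : realType) (t c : R) : 0 <= t ->
  Cb_plus (fun x : R => expR (Num.min x c * t)).
Proof.
move=> t0; split.
- move=> x; apply: (@continuous_comp _ _ _ (fun x => Num.min x c * t) expR).
    apply: continuousM; last exact: cst_continuous.
    by apply: continuous_min => //; exact: cst_continuous.
  exact: continuous_expR.
- exists (expR (c * t)); split; first exact: num_real.
  move=> x cx w _ /=; rewrite ger0_norm ?expR_ge0//.
  apply: le_trans (ltW cx); rewrite ler_expR ler_wpM2r//.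
  by rewrite ge_min lexx orbT.
- by move=> x; exact: expR_ge0.
Qed.

(** Negative association only controls the upper expectation of the product;
    the bound still holds for each single P of PP, the
    expectation under P being at most the upper one. *)
Lemma negatively_associated_chernoff d (T : measurableType d) (R : realType)
    (PP : set (probability T R)) (X : nat -> {mfun T >-> R}) (p M : R)
    (m c : nat -> R) (n : nat) (t a : R) (P : probability T R) :
  negatively_associated PP (fun i => X i : T -> R) -> 1 <= p <= 2 ->
  (forall i Q, PP Q -> ('E_Q[fun w => (`|X i w| `^ p)%R] <= M%:E)%E) ->
  (forall i Q, PP Q -> ('E_Q[X i] <= (m i)%:E)%E) ->
  0 < t -> (forall i, (i < n)%N -> 0 <= c i /\ t * c i <= 2^-1) -> PP P ->
  (P [set w | (a <= \sum_(i < n) Num.min (X i w) (c i))%R]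
    <= (expR (t * (\sum_(i < n) m i) + 2 * M * t `^ p * n%:R - t * a))%:E)%E.
Proof.
move=> NA p12 XM Xm t0 tc PPP.
have mY : measurable_fun setT (fun w => \sum_(i < n) Num.min (X i w) (c i)).
  by apply: measurable_sum => i; apply: measurable_minr.
pose Y : {mfun T >-> R} := mfun_Sub (mem_set mY).
apply: le_trans (@chernoff _ _ _ P Y t a t0) _.
rewrite expRD EFinM lee_wpmul2r ?lee_fin ?expR_ge0// /mmt_gen_fun.
pose f i (x : R) := expR (Num.min x (c i) * t).
have -> : expR \o t \o* Y = (fun w => \prod_(i < n) f i (X i w)).
  by apply/funext => w /=; rewrite mulr_suml expR_sum.
apply: (@le_trans _ _ (upper_expectation PP (fun w => \prod_(i < n) f i (X i w)))).
  by apply: ereal_sup_ubound; exists P.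
apply: le_trans (negatively_associated_prod_le (f := f) n
  (ex_intro _ P PPP) NA _ _) _.
- by move=> i; apply: Cb_plus_expR_minr; exact: ltW.
- left=> i x y xy; rewrite ler_expR ler_wpM2r ?(ltW t0)//.
  by rewrite le_min2 //.
have -> : t * (\sum_(i < n) m i) + 2 * M * t `^ p * n%:R =
    \sum_(i < n) (t * m i + 2 * M * t `^ p).
  by rewrite big_split/= mulr_sumr sumr_const card_ord mulr_natr.
rewrite expR_sum -prodEFin.
suff : (0 <= \prod_(i < n) upper_expectation PP (fun w => f i (X i w)) <=
  \prod_(i < n) (expR (t * m i + 2 * M * t `^ p))%:E)%E by case/andP.
apply: (big_ind2 (fun x y => (0 <= x <= y)%E)).
- by rewrite lee_fin ler01 lexx.
- by move=> x1 x2 y1 y2 /andP[? ?] /andP[? ?]; rewrite mule_ge0// lee_pmul.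
- move=> i _; have [c0 tci] := tc i (ltn_ord i); apply/andP; split.
    apply: (@le_trans _ _ 'E_P[fun w => f i (X i w)]%E).
      by apply: expectation_ge0 => w; exact: expR_ge0.
    by apply: ereal_sup_ubound; exists P.
  apply: ge_ereal_sup => _ [Q QP <-].
  by apply: expectation_expR_minr_le => //; [exact: XM|exact: Xm].
Qed.

(** Chernoff's bound with t = n^(-b) / 2, the largest value that keeps t times
    all truncation levels at most 1/2. The error term 2 M t^p n is then
    negligible with respect to t e n, because p > 1 and t tends to 0; what is
    left is exp(- e n^(1-b) / 4), smaller than any power of n. *)
Lemma negatively_associated_truncated_tail d (T : measurableType d)
    (R : realType) (PP : set (probability T R)) (X : nat -> {mfun T >-> R})
    (p M b s e : R) (m : nat -> R) (P : probability T R) :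
  negatively_associated PP (fun i => X i : T -> R) -> 1 < p <= 2 ->
  (forall i Q, PP Q -> ('E_Q[fun w => (`|X i w| `^ p)%R] <= M%:E)%E) ->
  (forall i Q, PP Q -> ('E_Q[X i] <= (m i)%:E)%E) ->
  0 < b < 1 -> 0 < s -> 0 < e -> PP P ->
  exists K : R, \forall n \near \oo,
   (P [set w | (\sum_(i < n.+1) m i + e * n.+1%:R
                 <= \sum_(i < n.+1) Num.min (X i w) (i.+1%:R `^ b))%R]
     <= (K * riemannR s n)%:E)%E.
Proof.
move=> NA /andP[p1 p2] XM Xm /andP[b0 b1] s0 e0 PPP.
have M0 : 0 <= M.
  rewrite -lee_fin; apply: le_trans (XM 0%N P PPP).
  by apply: expectation_ge0 => w; exact: powR_ge0.
pose g := 1 - b; have g0 : 0 < g by rewrite subr_gt0.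
(* With this k, the bound ((e/4) n^g / k)^(-k) decays exactly like n^(-s). *)
pose k := s / g; have k0 : 0 < k by rewrite divr_gt0.
exists ((e / 4 / k) `^ (- k)).
have bp0 : 0 < b * (p - 1) by rewrite mulr_gt0// subr_gt0.
have eM0 : 0 < e / 4 / (M + 1) by rewrite !divr_gt0// ltr_wpDl.
near=> n.
have n0 : (0 : R) < n.+1%:R by rewrite ltr0n.
pose t : R := n.+1%:R `^ (- b) / 2.
have t0 : 0 < t by rewrite divr_gt0// powR_gt0.
apply: le_trans (@negatively_associated_chernoff _ _ _ PP X p M m
  (fun i => i.+1%:R `^ b) n.+1 t _ P NA _ XM Xm t0 _ PPP) _.
- by rewrite p2 ltW.
- move=> i iN; split; first exact: powR_ge0.
  rewrite /t mulrAC -[leRHS]mul1r ler_pM2r ?invr_gt0// powRN mulrC.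
  rewrite ler_pdivrMr ?powR_gt0// mul1r ge0_ler_powR ?nnegrE ?(ltW b0)//.
  by rewrite ler_nat.
rewrite lee_fin mulrDr.
have -> : forall x y z : R, x + y - (x + z) = y - z by move=> *; ring.
have small : 2 * M * t `^ p <= t * (e / 2).
  rewrite -(mulr_powRB1 (ltW t0)); last lra.
  rewrite mulrCA ler_pM2l//.
  (* Divide by M + 1 rather than M, which may vanish. *)
  have h : t `^ (p - 1) <= e / 4 / (M + 1).
    apply: (@le_trans _ _ (n.+1%:R `^ (- (b * (p - 1))))); last first.
      by near: n; exact: near_powRN_le.
    rewrite -mulNr powRrM ge0_ler_powR ?nnegrE ?powR_ge0 ?(ltW t0)//.
      by rewrite subr_ge0 ltW.
    by rewrite /t ler_pdivrMr// ler_peMr ?powR_ge0// ler1n.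
  apply: (@le_trans _ _ (2 * (M + 1) * (e / 4 / (M + 1)))).
    by apply: ler_pM; rewrite ?mulr_ge0 ?powR_ge0//; lra.
  rewrite le_eqVlt; apply/orP; left; apply/eqP; field.
  by rewrite gt_eqF// ltr_wpDl.
have tn : t * n.+1%:R = n.+1%:R `^ g / 2.
  rewrite /t mulrAC /g addrC powRD ?(gt_eqF n0) ?implybT//.
  by rewrite powRr1 ?(ltW n0).
have ng0 : 0 < n.+1%:R `^ g :> R by rewrite powR_gt0.
apply: (@le_trans _ _ (expR (- (e / 4 * n.+1%:R `^ g)))).
  rewrite ler_expR.
  have := ler_wpM2r (ltW n0) small.
  have -> : t * (e / 2) * n.+1%:R = t * n.+1%:R * (e / 2) by ring.
  have -> : t * (e * n.+1%:R) = t * n.+1%:R * e by ring.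
  rewrite tn; lra.
apply: le_trans (expRN_le_powR k0 _) _; first by rewrite mulr_gt0// divr_gt0.
rewrite mulrAC [leLHS]powRM ?divr_ge0 ?(ltW s0) ?(ltW g0) ?(ltW ng0) ?(ltW e0)//.
rewrite -powRrM mulrN /k [g * _]mulrC divfK ?gt_eqF//.
by rewrite /riemannR -powRN.
Unshelve. all: by end_near. Qed.

(** * The one-sided strong law *)

(** If the truncation changes only finitely many terms, the sums and the
    truncated sums differ by an eventually constant amount, which the extra
    e n absorbs. *)
Lemma eventually_sum_le_of_truncation (R : realType) (x m c : nat -> R) (e : R) :
  0 < e -> (\forall n \near \oo, ~ c n < x n) ->
  (\forall n \near \oo, ~ \sum_(i < n.+1) m i + e * n.+1%:R
    <= \sum_(i < n.+1) Num.min (x i) (c i)) ->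
  \forall n \near \oo, \sum_(i < n) (x i - m i) <= n%:R * (2 * e).
Proof.
move=> e0 [N _ xc] tr.
pose A n := \sum_(i < n) (x i - Num.min (x i) (c i)).
have AN k : A (N + k)%N = A N.
  elim: k => [|k ih]; first by rewrite addn0.
  rewrite addnS /A big_ord_recr/= -/(A _) ih min_l ?subrr ?addr0//.
  by rewrite leNgt; apply/negP/xc; exact: leq_addr.
have : \forall n \near \oo, \sum_(i < n.+1) (x i - m i) <= n.+1%:R * (2 * e).
  near=> n.
  have -> : \sum_(i < n.+1) (x i - m i) =
      A n.+1 + \sum_(i < n.+1) Num.min (x i) (c i) - \sum_(i < n.+1) m i.
    by rewrite -big_split/= -sumrB; apply: eq_bigr => i _; rewrite subrK.
  have /negP : ~ \sum_(i < n.+1) m i + e * n.+1%:R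
    <= \sum_(i < n.+1) Num.min (x i) (c i) by near: n.
  rewrite -ltNge => trn.
  have Nn : (N <= n.+1)%N by apply: leqW; near: n; exact: nbhs_infty_ge.
  rewrite -(subnKC Nn) AN subnKC//.
  have : A N <= e * n.+1%:R.
    rewrite mulrC -ler_pdivrMr//.
    apply: (@le_trans _ _ n%:R); last by rewrite ler_nat.
    by near: n; exact: nbhs_infty_ger.
  move: trn; lra.
(* Both hypotheses concern sums of n + 1 terms: shift the index back. *)
by move=> [k _ H]; exists k.+1 => // -[|n]//= kn; exact: H.
Unshelve. all: by end_near. Qed.

(** The one-sided strong law, for arbitrary upper bounds m_i of the means. The
    truncation exponent b = 2 / (1 + p) satisfies b < 1 < b p, and k indexes
    countably many precisions so that the exceptional null sets can be
    gathered into one. *)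
Lemma negatively_associated_ae_sum_le d (T : measurableType d) (R : realType)
    (PP : set (probability T R)) (X : nat -> {mfun T >-> R}) (p M : R)
    (m : nat -> R) (P : probability T R) :
  negatively_associated PP (fun i => X i : T -> R) -> 1 < p <= 2 ->
  (forall i Q, PP Q -> ('E_Q[fun w => (`|X i w| `^ p)%R] <= M%:E)%E) ->
  (forall i Q, PP Q -> ('E_Q[X i] <= (m i)%:E)%E) -> PP P ->
  {ae P, forall w, forall k : nat, \forall n \near \oo,
    \sum_(i < n) (X i w - m i) <= n%:R * k.+1%:R^-1}.
Proof.
move=> NA p12 XM Xm PPP; have /andP[p1 p2] := p12.
pose b := 2 / (1 + p).
have b01 : 0 < b < 1.
  rewrite /b divr_gt0//=; last lra.
  rewrite ltr_pdivrMr; lra.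
have /andP[b0 b1] := b01.
have s1 : 1 < b * p.
  rewrite /b mulrAC ltr_pdivlMr; lra.
have tail : {ae P, forall w, \forall n \near \oo, ~ n.+1%:R `^ b < X n w}.
  apply: (@ae_eventually_notin _ _ _ P (fun n => [set w | n.+1%:R `^ b < X n w])
    M _ s1).
    by move=> n; exact: measurable_set_ltr.
  apply: nearW => n; rewrite /riemannR -powRN -mulrN (powRrM _ b).
  have c0 : 0 < n.+1%:R `^ b :> R by rewrite powR_gt0.
  exact: (powR_moment_tail_le (ltW (lt_trans ltr01 p1)) c0 (XM n P PPP)).
apply: ae_foralln => k.
(* Half the precision for the deviation of the truncated sums, half for the
   effect of the truncation. *)
have e0 : 0 < (k.+1%:R : R)^-1 / 2 by rewrite divr_gt0// invr_gt0.
have [K HK] := negatively_associated_truncated_tail NA p12 XM Xm b01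
  (lt_trans ltr01 s1) e0 PPP.
have trunc := ae_eventually_notin s1 _ HK.
apply: filterS2 tail (trunc _) => [w tw trw|n]; last first.
  apply: measurable_set_ler; apply: measurable_sum => i.
  exact: measurable_minr.
have := eventually_sum_le_of_truncation e0 tw trw.
by rewrite mulrC divfK// gt_eqF.
Qed.

Lemma limn_esup_le_near (R : realType) (u : nat -> \bar R) (l : \bar R) :
  (\forall n \near \oo, (u n <= l)%E) -> (limn_esup u <= l)%E.
Proof.
move=> ul; apply: (@le_trans _ _ (ereal_sup (u @` [set n | (u n <= l)%E]))).
  by apply: ereal_inf_lbound; exists [set n | (u n <= l)%E].
by apply: ge_ereal_sup => _ [n /= un <-].
Qed.

Lemma centered_meanE (T : Type) (R : realType) (X : nat -> T -> R)
    (m : nat -> R) (w : T) (n : nat) :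
  centered_mean X (fun i => (m i)%:E) w n =
  ((\sum_(i < n) (X i w - m i)) / n%:R)%:E.
Proof.
by rewrite /centered_mean EFinM -sumEFin.
Qed.

Lemma measurable_centered_mean d (T : measurableType d) (R : realType)
    (X : nat -> {mfun T >-> R}) (m : nat -> R) (n : nat) :
  measurable_fun setT
    (fun w => centered_mean (fun i => X i : T -> R) (fun i => (m i)%:E) w n).
Proof.
under eq_fun do rewrite centered_meanE.
apply/measurable_EFinP; apply: measurable_funM => //.
apply: measurable_sum => i.
exact: measurable_funB.
Qed.

Lemma measurable_limn_esup_centered_mean_gt0 d (T : measurableType d)
    (R : realType) (X : nat -> {mfun T >-> R}) (m : nat -> R) :
  measurable [set w | (0 < limn_esup (centered_mean (fun i => X i : T -> R)
    (fun i => (m i)%:E) w))%E].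
Proof.
rewrite -[X in measurable X]setTI; apply: emeasurable_fun_o_infty => //.
by apply: measurable_fun_limn_esup => n; exact: measurable_centered_mean.
Qed.

Lemma negatively_associated_limn_esup_le0 d (T : measurableType d)
    (R : realType) (PP : set (probability T R)) (X : nat -> {mfun T >-> R})
    (p M : R) (m : nat -> R) (P : probability T R) :
  negatively_associated PP (fun i => X i : T -> R) -> 1 < p <= 2 ->
  (forall i Q, PP Q -> ('E_Q[fun w => (`|X i w| `^ p)%R] <= M%:E)%E) ->
  (forall i Q, PP Q -> ('E_Q[X i] <= (m i)%:E)%E) -> PP P ->
  P [set w | (0 < limn_esup (centered_mean (fun i => X i : T -> R)
    (fun i => (m i)%:E) w))%E] = 0%E.
Proof.
move=> NA p12 XM Xm PPP.
apply: measure_negligible.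
  exact: measurable_limn_esup_centered_mean_gt0.
apply: negligibleS (negatively_associated_ae_sum_le NA p12 XM Xm PPP).
move=> w /= pos H; move: pos; apply/negP; rewrite -leNgt.
apply/lee_addgt0Pr => e e0; rewrite add0e.
have [k _ /(_ k (leqnn k))/= ke] := near_infty_natSinv_lt (PosNum e0).
apply: limn_esup_le_near; near=> n.
rewrite centered_meanE lee_fin (le_trans _ (ltW ke))//.
have n0 : (0 : R) < n%:R by rewrite ltr0n; near: n; exact: nbhs_infty_gt.
rewrite ler_pdivrMr// mulrC; near: n; exact: H.
Unshelve. all: by end_near. Qed.

(** * Upper and lower probabilities *)

Lemma upper_prob_eq0 d (T : measurableType d) (R : realType)
    (PP : set (probability T R)) (A : set T) :
  PP !=set0 -> (forall P, PP P -> P A = 0%E) -> upper_prob PP A = 0%E.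
Proof.
move=> [P0 PP0] PA; apply/eqP; rewrite eq_le; apply/andP; split.
  by apply: ge_ereal_sup => _ [P PPP <-]; rewrite PA.
by apply: ereal_sup_ubound; exists P0 => //; exact: PA.
Qed.

Lemma lower_prob_eq1 d (T : measurableType d) (R : realType)
    (PP : set (probability T R)) (A : set T) :
  PP !=set0 -> (forall P, PP P -> P A = 1%E) -> lower_prob PP A = 1%E.
Proof.
move=> [P0 PP0] PA; apply/eqP; rewrite eq_le; apply/andP; split.
  by apply: ereal_inf_lbound; exists P0 => //; exact: PA.
by apply: le_ereal_inf_tmp => _ [P PPP <-]; rewrite PA.
Qed.

Theorem theorem4p3 (R : realType) (d : measure_display) (T : measurableType d)
    (PP : set (probability T R)) (PP0 : PP !=set0)
    (X : nat -> {mfun T >-> R}) (alpha : R) (alpha_gt0 : 0 < alpha)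
    (X_na : negatively_associated PP (fun i => X i : T -> R))
    (X_moment : (ereal_sup (range (fun i : nat =>
       upper_expectation PP (fun w => (`|X i w| `^ (alpha + 1))%R))) < +oo)%E) :
  let Y (w : T) : nat -> \bar R :=
    centered_mean (fun i => X i : T -> R) (fun i => lower_expectation PP (X i)) w in
  let Z (w : T) : nat -> \bar R :=
    centered_mean (fun i => X i : T -> R) (fun i => upper_expectation PP (X i)) w in
  [/\ upper_prob PP ([set w | (limn_einf (Y w) < 0)%E] `|`
                     [set w | (0 < limn_esup (Z w))%E]) = 0%E,
      lower_prob PP [set w | (0 <= limn_einf (Y w))%E] = 1%E
    & lower_prob PP [set w | (limn_esup (Z w) <= 0)%E] = 1%E ].

Proof.
pose B := ereal_sup (range (fun i : nat =>
  upper_expectation PP (fun w => (`|X i w| `^ (alpha + 1))%R))).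
have XB i Q : PP Q -> ('E_Q[fun w => (`|X i w| `^ (alpha + 1))%R] <= B)%E.
  move=> QP; apply: (@le_trans _ _
      (upper_expectation PP (fun w => (`|X i w| `^ (alpha + 1))%R))).
    by apply: ereal_sup_ubound; exists Q.
  by apply: ereal_sup_ubound; exists i.
have [P0 P0P] := PP0.
have Bfin : B \is a fin_num.
  rewrite ge0_fin_numE//; apply: le_trans (XB 0%N P0 P0P).
  by apply: expectation_ge0 => w; exact: powR_ge0.
(* Capping alpha at 1 puts the exponent in the range of the inequality
   e^x <= 1 + x + 2|x|^p. *)
pose p := 1 + Num.min alpha 1.
have p12 : 1 < p <= 2.
  by rewrite /p ltrDl lt_min alpha_gt0 ltr01/= -lerBrDl ge_min; apply/orP; right; lra.
have /andP[p1 p2] := p12.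
have XM i Q : PP Q -> ('E_Q[fun w => (`|X i w| `^ p)%R] <= (1 + fine B)%:E)%E.
  move=> QP; apply: le_trans (expectation_powR_le_1D (p := alpha + 1) _ _ _) _.
  - by rewrite (le_trans ler01 (ltW p1))/= /p addrC lerD2r ge_min lexx.
  - by [].
  - exact: le_lt_trans (XB i Q QP) X_moment.
  - by rewrite EFinD leeD2l// fineK//; exact: XB.
pose K := 1 + (1 + fine B).
have EK i Q : PP Q -> ((- K)%:E <= 'E_Q[X i] <= K%:E)%E.
  move=> QP; have XK := abse_expectation_le_powR_moment (ltW p1) (XM i Q QP).
  by rewrite EFinN leeNl (le_trans _ XK) ?(le_trans _ XK) ?lee_abs// -abseN lee_abs.
have ufin i : upper_expectation PP (X i) \is a fin_num.
  rewrite fin_numElt; apply/andP; split.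
    apply: (@lt_le_trans _ _ (- K)%:E); first by rewrite ltNyr.
    apply: (@le_trans _ _ 'E_P0[X i]%E); first by case/andP: (EK i P0 P0P).
    by apply: ereal_sup_ubound; exists P0.
  apply: (@le_lt_trans _ _ K%:E); last by rewrite ltry.
  by apply: ge_ereal_sup => _ [Q QP <-]; case/andP: (EK i Q QP).
have lfin i : lower_expectation PP (X i) \is a fin_num.
  rewrite fin_numElt; apply/andP; split.
    apply: (@lt_le_trans _ _ (- K)%:E); first by rewrite ltNyr.
    by apply: le_ereal_inf_tmp => _ [Q QP <-]; case/andP: (EK i Q QP).
  apply: (@le_lt_trans _ _ K%:E); last by rewrite ltry.
  apply: (@le_trans _ _ 'E_P0[X i]%E); last by case/andP: (EK i P0 P0P).
  by apply: ereal_inf_lbound; exists P0.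
pose u i := fine (upper_expectation PP (X i)).
pose l i := fine (lower_expectation PP (X i)).
pose X' i : {mfun T >-> R} := - X i.
pose A := [set w | (0 < limn_esup (centered_mean (fun i => X' i : T -> R)
  (fun i => (- l i)%:E) w))%E].
pose C := [set w | (0 < limn_esup (centered_mean (fun i => X i : T -> R)
  (fun i => (u i)%:E) w))%E].
have mA : measurable A by exact: measurable_limn_esup_centered_mean_gt0.
have mC : measurable C by exact: measurable_limn_esup_centered_mean_gt0.
have C0 P : PP P -> P C = 0%E.
  apply: (negatively_associated_limn_esup_le0 X_na p12 XM) => i Q QP.
  by rewrite fineK//; apply: ereal_sup_ubound; exists Q.
have A0 P : PP P -> P A = 0%E.
  have NA' : negatively_associated PP (fun i => X' i : T -> R).
    exact: negatively_associatedN X_na.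
  apply: (@negatively_associated_limn_esup_le0 _ _ _ PP X' p (1 + fine B)
    (fun i => - l i) P NA' p12).
    move=> i Q QP; apply: le_trans (XM i Q QP).
    by rewrite /X'/=; under eq_fun do rewrite normrN.
  move=> i Q QP.
  have -> : ('E_Q[X' i] = - 'E_Q[X i])%E.
    apply: expectationN; apply: (integrable_of_powR_moment (ltW p1)) => //.
    by apply: le_lt_trans (XM i Q QP) _; rewrite ltry.
  rewrite EFinN leeN2 fineK//.
  by apply: ereal_inf_lbound; exists Q.
move=> Y Z.
have uE : (fun i => upper_expectation PP (X i)) = (fun i => (u i)%:E).
  by apply/funext => i; rewrite fineK.
have lE : (fun i => lower_expectation PP (X i)) = (fun i => (l i)%:E).
  by apply/funext => i; rewrite fineK.
have ZC : [set w | (0 < limn_esup (Z w))%E] = C by rewrite /Z uE.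
have YN w : limn_einf (Y w) = (- limn_esup (centered_mean
    (fun i => X' i : T -> R) (fun i => (- l i)%:E) w))%E.
  rewrite /limn_einf; congr (- limn_esup _)%E; apply/funext => n.
  rewrite /Y lE !centered_meanE -EFinN -mulNr -sumrN; congr ((_ / _)%:E).
  by apply: eq_bigr => i _; rewrite opprB opprK addrC.
have YA : [set w | (limn_einf (Y w) < 0)%E] = A.
  by apply/seteqP; split=> w; rewrite /A /= YN oppe_lt0.
split.
- rewrite YA ZC; apply: upper_prob_eq0 => // P PPP.
  by rewrite measureU0//; [exact: A0|exact: C0].
- have -> : [set w | (0 <= limn_einf (Y w))%E] = ~` A.
    by rewrite -YA; apply/seteqP; split=> w /=; rewrite leNgt => /negP.
  apply: lower_prob_eq1 => // P PPP.
  by rewrite probability_setC// A0// sube0.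
- have -> : [set w | (limn_esup (Z w) <= 0)%E] = ~` C.
    by rewrite -ZC; apply/seteqP; split=> w /=; rewrite leNgt => /negP.
  apply: lower_prob_eq1 => // P PPP.
  by rewrite probability_setC// C0// sube0.
Qed.
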